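(* Let $n\ge 1$, $d\ge 0$, $X=\{x_1,\dots,x_n\}$, $U=\{u_1,\dots,u_d\}$. The generic Macdonald polynomial $$ I_U(X)=\sum_{f:\{1,\dots,d\}\to\{1,\dots,n\}} \Bigl(\prod_{(i,j):\, f(i)<f(j)}\rho(u_i/u_j)\Bigr)\, \prod_{i=1}^d \left(x_{f(i)} + \frac{u_i}{t^{f(i)}} + \frac{t^{f(i)}}{u_i}\right) \in \mathbb{Q}(u_1,\dots,u_d,q,t)[x_1,\dots,x_n] $$ is symmetric in $x_1,\dots,x_n$.
   Context: $q,t,u_1,\dots,u_d,x_1,\dots,x_n$ are independent indeterminates and $$\rho(v)=\frac{(1-qv)(1-tv/q)}{(1-v)(1-tv)}.$$ The sum is over all $n^d$ functions $f$, and the first product is over all pairs $i,j\in\{1,\dots,d\}$ with $f(i)<f(j)$ (the condition is on the values of $f$; there is no condition on the order of $i$ and $j$). *)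

(* Defs.v *)
From mathcomp Require Import all_boot all_algebra.
From mathcomp Require Export mpoly.

Set Implicit Arguments.
Unset Strict Implicit.
Unset Printing Implicit Defensive.

Import GRing.Theory.
Local Open Scope ring_scope.

Definition rho (K : fieldType) (q t v : K) : K :=
  ((1 - q * v) * (1 - t * v / q)) / ((1 - v) * (1 - t * v)).

(* Values of f run over 'I_n = {0, ..., n-1} instead of {1, ..., n}, so the
   exponent of t attached to the value f i is (f i).+1. *)
Definition generic_macdonald (K : fieldType) (n d : nat) (q t : K)
    (u : 'I_d -> K) : {mpoly K[n]} :=
  \sum_(f : {ffun 'I_d -> 'I_n})
     (\prod_(p : 'I_d * 'I_d | (f p.1 < f p.2)%N) rho q t (u p.1 / u p.2))
     *: \prod_(i < d)
          ('X_(f i) + (u i / t ^+ (f i).+1 + t ^+ (f i).+1 / u i)%:MP).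

(* The field Q(u_1, ..., u_d, q, t): the 2 + d indeterminates are, in order,
   q, t, u_1, ..., u_d. *)
Definition coef_field (d : nat) : fieldType := {fraction {mpoly rat[2 + d]}}.

Definition indet (d : nat) (k : 'I_(2 + d)) : coef_field d :=
  tofrac ('X_k : {mpoly rat[2 + d]}).

Definition q_indet (d : nat) : coef_field d := indet (lshift d (ord0 : 'I_2)).
Definition t_indet (d : nat) : coef_field d := indet (lshift d (ord_max : 'I_2)).
Definition u_indet (d : nat) (i : 'I_d) : coef_field d := indet (rshift 2 i).

(* Main.v *)
Require Import Defs.
From mathcomp Require Import all_boot all_algebra.
From mathcomp Require Import mpoly.
From mathcomp Require Import perm ring zify.

Set Implicit Arguments.
Unset Strict Implicit.
Unset Printing Implicit Defensive.

Import GRing.Theory.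
Local Open Scope ring_scope.

(** It suffices to exchange [x_a] and [x_(a+1)]. Grouping the functions [f] that
    differ only by the choice between the values [a] and [a+1] reduces this to
    two variables, that is, to the symmetry in [x] and [y] of
    [F_S(x,y) = sum_(A \subset S) prod_(i in A, j in S \ A) rho(v_i/v_j)
       * prod_(i in A) (x + v_i + 1/v_i) * prod_(j in S \ A) (y + v_j/t + t/v_j)],
    which is proved by induction on [#|S|]. As a function of one variable
    [z = v_k], the difference [F_S(x,y) - F_S(y,x)] has no pole at the other
    [v_j] (the residues for [k in A] and [j in A] cancel), none at [v_j t] and
    [v_j / t] (since [rho(1/(tw)) = rho(w)], the residue is symmetric in [x, y] up
    to the symmetric factor [F_(S \ {j,k})]), and the extreme terms of its
    expansions at [0] and [oo] are multiples of [F_(S \ k)]. Hence it is [0]: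
    after clearing denominators, a polynomial with more roots than its degree. *)

(** * Extreme coefficients of a quadratic times a product of cubics *)

Section PolyFacts.
Variable R : comNzRingType.
Implicit Types p r : {poly R}.

Lemma coef1M p r : (p * r)`_1 = p`_0 * r`_1 + p`_1 * r`_0.
Proof. by rewrite coefM big_ord_recl big_ord1. Qed.

Lemma coefM_top m n p r : (size p <= m.+1)%N -> (size r <= n.+1)%N ->
  (p * r)`_(m + n) = p`_m * r`_n.
Proof.
move=> sp sr; have lt_m : (m < (m + n).+1)%N by rewrite ltnS leq_addr.
rewrite coefM (bigD1 (Ordinal lt_m)) //= addKn big1 ?addr0 // => i.
rewrite -val_eqE /= neq_ltn => /orP[lt_im|lt_mi].
  rewrite [r`__]nth_default ?mulr0 // (leq_trans sr) //.
  by rewrite ltn_subRL ltn_add2r.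
by rewrite [p`__]nth_default ?mul0r // (leq_trans sp).
Qed.

Lemma size_mul_leqS m n p r : (size p <= m.+1)%N -> (size r <= n.+1)%N ->
  (size (p * r)%R <= (m + n).+1)%N.
Proof. by move=> sp sr; apply: leq_trans (size_polyMleq _ _) _; lia. Qed.

Definition quadratic (a b c : R) : {poly R} := Poly [:: a; b; c].

(** Parametrized by reciprocals of roots, so that the constant term is always 1. *)
Definition cubic (a b c : R) : {poly R} :=
  (1 - a *: 'X) * (1 - b *: 'X) * (1 - c *: 'X).

Lemma horner_quadratic a b c z :
  (quadratic a b c).[z] = a + b * z + c * z ^+ 2.
Proof. by rewrite /quadratic horner_Poly /=; ring. Qed.

Lemma horner_cubic a b c z :
  (cubic a b c).[z] = (1 - a * z) * (1 - b * z) * (1 - c * z).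
Proof. by rewrite /cubic !hornerE. Qed.

Lemma cubicE a b c : cubic a b c =
  Poly [:: 1; - (a + b + c); a * b + b * c + a * c; - (a * b * c)].
Proof.
rewrite /cubic /= !cons_poly_def !(mul0r, add0r) -!mul_polyC.
by rewrite !(rmorphD, rmorphN, rmorphM, rmorph1) /=; ring.
Qed.

Section ProdCubic.
Variables (I : finType) (S : {set I}) (a b c : I -> R).
Let P := \prod_(k in S) cubic (a k) (b k) (c k).

Lemma prod_cubic_coef0 : P`_0 = 1.
Proof.
rewrite /P; elim/big_rec: _ => [|k p _ IH]; first by rewrite coef1.
by rewrite coef0M IH mulr1 cubicE coef_Poly.
Qed.

Lemma prod_cubic_coef1 : P`_1 = - \sum_(k in S) (a k + b k + c k).
Proof.
suff [] : P`_0 = 1 /\ P`_1 = - \sum_(k in S) (a k + b k + c k) by [].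
rewrite /P; elim/big_rec2: _ => [|k s p _ [IH0 IH1]].
  by rewrite !coef1 oppr0.
by rewrite coef0M coef1M IH0 IH1 cubicE !coef_Poly /=; split; ring.
Qed.

Lemma prod_cubic_top : (size P <= (3 * #|S|).+1)%N /\
  P`_(3 * #|S|) = \prod_(k in S) - (a k * b k * c k).
Proof.
rewrite /P -sum1_card.
elim/big_rec3: _ => [|k s m p _ [IHs IHt]].
  by rewrite muln0 size_poly1 coef1.
rewrite mulnDr muln1.
have sc : (size (cubic (a k) (b k) (c k)) <= 4)%N.
  by rewrite cubicE (leq_trans (size_Poly _)).
by rewrite size_mul_leqS // coefM_top // IHt cubicE coef_Poly.
Qed.

Variables (q0 q1 q2 : R).
Let Q := quadratic q0 q1 q2 * P.

Lemma quadratic_prod_cubic_coef0 : Q`_0 = q0.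
Proof. by rewrite /Q coef0M prod_cubic_coef0 coef_Poly mulr1. Qed.

Lemma quadratic_prod_cubic_coef1 :
  Q`_1 = q1 - q0 * \sum_(k in S) (a k + b k + c k).
Proof.
rewrite /Q coef1M prod_cubic_coef0 prod_cubic_coef1 !coef_Poly /=; ring.
Qed.

Lemma quadratic_prod_cubic_top : (size Q <= (2 + 3 * #|S|).+1)%N /\
  Q`_(2 + 3 * #|S|) = q2 * \prod_(k in S) - (a k * b k * c k).
Proof.
have [sP tP] := prod_cubic_top.
have sq : (size (quadratic q0 q1 q2) <= 3)%N by exact: size_Poly.
by rewrite /Q size_mul_leqS // coefM_top // tP coef_Poly.
Qed.

End ProdCubic.

End PolyFacts.

(** The two low coefficients let ['X^2] be divided out, and the missing top coefficient leaves a
    quotient of degree less than [m]. The points of [s] are nonzero, so they are at least [m]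
    distinct roots of that quotient. *)
Lemma double_root0_poly_eq0 (R : idomainType) m (p : {poly R}) (s : seq R) :
  (size p <= (2 + m).+1)%N -> p`_0 = 0 -> p`_1 = 0 -> p`_(2 + m) = 0 ->
  uniq (0 :: s) -> (m <= size s)%N -> all (root p) s -> p = 0.
Proof.
move=> sp p0 p1 ptop /= /andP[s0 us] ms rs.
have dp : p = drop_poly 2 p * 'X^2.
  rewrite -{1}(poly_take_drop 2 p) (_ : take_poly 2 p = 0) ?add0r //.
  by apply/polyP=> -[|[|i]]; rewrite coef_take_poly coef0.
rewrite dp (_ : drop_poly 2 p = 0) ?mul0r //.
apply: (@roots_geq_poly_eq0 _ _ s _ us).
  apply/allP=> z zs; have := allP rs z zs; rewrite {1}dp rootM.
  case/orP=> //; rewrite rootE !hornerE expf_eq0 /= => /eqP z0.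
  by rewrite -z0 zs in s0.
rewrite size_drop_poly (leq_trans _ ms) // leq_subLR.
have [lt|//] := ltnP (2 + m) (size p).
have e : size p = (2 + m).+1 by apply/eqP; rewrite eqn_leq sp lt.
have : lead_coef p == 0 by rewrite lead_coefE e ptop.
by rewrite lead_coef_eq0 => /eqP p00; rewrite p00 size_poly0 in e.
Qed.

Lemma big_subset_setU1 (V : nmodType) (I : finType) (k : I) (S : {set I})
    (h : {set I} -> V) : k \notin S ->
  \sum_(A : {set I} | A \subset k |: S) h A =
  \sum_(A : {set I} | A \subset S) (h A + h (k |: A)).
Proof.
move=> kS; rewrite (bigID (fun A : {set I} => k \in A)) /= addrC big_split /=.
congr (_ + _); first by apply: eq_bigl => A; rewrite -subsetD1 setU1K.
rewrite (reindex_onto (fun A => k |: A) (fun A => A :\ k)) /=; last first.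
  by move=> A /andP[_ kA]; rewrite setD1K.
apply: eq_bigl => A; rewrite setU11 andbT.
have [kA|kA] := boolP (k \in A).
  rewrite [A \subset S](negbTE _); last by apply: contra kS => /subsetP; apply.
  by apply/negP=> /andP[_ /eqP eA]; rewrite -eA setD11 in kA.
rewrite setU1K // eqxx andbT subUset sub1set setU11 -subDset.
by rewrite (setDidPl _) // disjoint_sym disjoints1.
Qed.

(** * Symmetry of the sum over subsets in two variables *)

Section TwoVariables.
Variables (L : fieldType) (I : finType) (q t : L) (v : I -> L).
Implicit Types (S A : {set I}) (x y z : L).

Definition plus_inv z := z + z^-1.

(** [A] holds the indices sent to the smaller of two adjacent values; the division by [t] is the
    extra power of [t] at the larger one. *)
Definition weight S A x y : L :=
  (\prod_(i in S) \prod_(j in S)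
     (if (i \in A) && (j \notin A) then rho q t (v i / v j) else 1))
  * \prod_(i in S)
     (if i \in A then x + plus_inv (v i) else y + plus_inv (v i / t)).

Definition subset_sum S x y : L :=
  \sum_(A : {set I} | A \subset S) weight S A x y.

(* In the unknown [z], [cubicD k] is a common denominator of [rho(z/v_k)] and
   [rho(v_k/z) = rho(z/(t v_k))]; [cubicA k] and [cubicB k] are its products
   with the former and the latter. *)
Definition cubicD k := cubic (1 / (t * v k)) (1 / v k) (t / v k).
Definition cubicA k := cubic (q / v k) (t / (q * v k)) (1 / (t * v k)).
Definition cubicB k := cubic (q / (t * v k)) (1 / (q * v k)) (t / v k).

(** The first summand puts the new index inside [A], the second outside; both are multiplied by [z]
    and by the common denominator. *)
Definition numer_term S A x y : {poly L} :=
  quadratic 1 x 1 * (\prod_(k in S) (if k \in A then cubicD k else cubicA k))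
  + quadratic t y t^-1 *
      \prod_(k in S) (if k \in A then cubicB k else cubicD k).

(* The numerator, as a polynomial in [z], of [subset_sum] over [S] plus one more
   index at which [v] takes the value [z]: see [horner_numer_setU1]. *)
Definition numer S x y : {poly L} :=
  \sum_(A : {set I} | A \subset S) weight S A x y *: numer_term S A x y.

Hypotheses (q0 : q != 0) (t0 : t != 0) (v0 : forall i, v i != 0).
(* The bound 2 makes the points [v k / t], [v k], [t * v k] pairwise distinct. *)
Hypothesis v_generic : forall i j e, (e <= 2)%N -> (i != j) || (0 < e)%N ->
  v i != t ^+ e * v j.

Lemma weight_setU1_notin S A x y k : k \notin S -> k \notin A ->
  weight (k |: S) A x y = weight S A x y * (y + plus_inv (v k / t)) *
    \prod_(i in S) (if i \in A then rho q t (v i / v k) else 1).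
Proof.
move=> kS kA; rewrite /weight !big_setU1 //= (negbTE kA) /=.
rewrite big1_eq mul1r.
under eq_bigr do rewrite big_setU1 //= kA andbT.
rewrite big_split /=; ring.
Qed.

Lemma weight_setU1 S A x y k : k \notin S -> k \notin A ->
  weight (k |: S) (k |: A) x y = weight S A x y * (x + plus_inv (v k)) *
    \prod_(j in S) (if j \in A then 1 else rho q t (v k / v j)).
Proof.
move=> kS kA; rewrite /weight !big_setU1 //= setU11 /= mul1r.
have inU i : i \in S -> (i \in k |: A) = (i \in A).
  by move=> iS; rewrite in_setU1; case: eqP => // e; rewrite -e iS in kS.
rewrite [X in X * _ * _ = _](_ : _ =
    \prod_(j in S) (if j \in A then 1 else rho q t (v k / v j))); last first.
  by apply: eq_bigr => j jS; rewrite inU //; case: (j \in A).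
rewrite [X in _ * X * _ = _](_ : _ = \prod_(i in S) \prod_(j in S)
     (if (i \in A) && (j \notin A) then rho q t (v i / v j) else 1)); last first.
  apply: eq_bigr => i iS; rewrite big_setU1 //= setU11 andbF mul1r.
  by apply: eq_bigr => j jS; rewrite !inU.
rewrite [X in _ * (_ * X) = _](_ : _ = \prod_(i in S)
     (if i \in A then x + plus_inv (v i) else y + plus_inv (v i / t))); last first.
  by apply: eq_bigr => i iS; rewrite inU.
ring.
Qed.

Lemma notin_subset k S A : k \notin S -> A \subset S -> k \notin A.
Proof. by move=> kS /subsetP AS; apply: contra kS; apply: AS. Qed.

Lemma sub_generic e i j : (e <= 2)%N -> (i != j) || (0 < e)%N ->
  v i - t ^+ e * v j != 0.
Proof. by move=> e2 ij; rewrite subr_eq0 v_generic. Qed.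

Ltac solve_generic := repeat (apply/andP; split); rewrite // -oppr_eq0 opprB //.

(** This is rho(1/(tw)) = rho(w) at w = v_i/v_k, since [cubicA i] is [cubicD i] times rho(z/v_i). *)
Lemma rho_cubicA_div i k : i != k ->
  rho q t (v i / v k) * (cubicD i).[v k / t] = (cubicA i).[v k / t].
Proof.
move=> ik; rewrite /rho !horner_cubic.
have := @sub_generic 0 i k isT; have := @sub_generic 1 k i isT.
rewrite ik eq_sym ik expr1 expr0 mul1r => /(_ isT) h1 /(_ isT) h2.
by field; solve_generic.
Qed.

Lemma rho_cubicB_mul i k : i != k ->
  rho q t (v k / v i) * (cubicD i).[t * v k] = (cubicB i).[t * v k].
Proof.
move=> ik; rewrite /rho !horner_cubic.
have := @sub_generic 0 i k isT; have := @sub_generic 1 i k isT.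
rewrite ik expr1 expr0 mul1r => /(_ isT) h1 /(_ isT) h2.
by field; solve_generic.
Qed.

Lemma rho_cubicB i k : i != k ->
  rho q t (v i / v k) * (cubicD i).[v k] = (cubicB i).[v k].
Proof.
move=> ik; rewrite /rho !horner_cubic.
have := @sub_generic 0 i k isT; have := @sub_generic 1 k i isT.
rewrite ik eq_sym ik expr1 expr0 mul1r => /(_ isT) h1 /(_ isT) h2.
by field; solve_generic.
Qed.

Lemma rho_cubicA i k : i != k ->
  rho q t (v k / v i) * (cubicD i).[v k] = (cubicA i).[v k].
Proof.
move=> ik; rewrite /rho !horner_cubic.
have := @sub_generic 0 i k isT; have := @sub_generic 1 i k isT.
rewrite ik expr1 expr0 mul1r => /(_ isT) h1 /(_ isT) h2.
by field; solve_generic.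
Qed.

Lemma quadraticA_plus_inv x z : z != 0 ->
  (quadratic 1 x 1).[z] = z * (x + plus_inv z).
Proof. by move=> z0; rewrite horner_quadratic /plus_inv; field. Qed.

Lemma quadraticB_plus_inv y z : z != 0 ->
  (quadratic t y t^-1).[z] = z * (y + plus_inv (z / t)).
Proof.
by move=> z0; rewrite horner_quadratic /plus_inv; field; rewrite t0 z0.
Qed.

Lemma neq_of_notin k S i : k \notin S -> i \in S -> i != k.
Proof. by move=> kS iS; apply: contra kS => /eqP <-. Qed.

Lemma horner_numer S x y z : (numer S x y).[z] =
  \sum_(A : {set I} | A \subset S) weight S A x y *
    ((quadratic 1 x 1).[z] *
       \prod_(k in S) (if k \in A then (cubicD k).[z] else (cubicA k).[z]) +
     (quadratic t y t^-1).[z] *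
       \prod_(k in S) (if k \in A then (cubicB k).[z] else (cubicD k).[z])).
Proof.
rewrite /numer horner_sum; apply: eq_bigr => A _.
rewrite hornerZ hornerD !hornerM !horner_prod.
by do 3![congr (_ * _)|congr (_ + _)]; apply: eq_bigr => k _; case: ifP.
Qed.

Lemma horner_numer_setU1 S x y k : k \notin S ->
  (numer S x y).[v k] =
  subset_sum (k |: S) x y * (v k * \prod_(j in S) (cubicD j).[v k]).
Proof.
move=> kS; rewrite horner_numer /subset_sum big_subset_setU1 // mulr_suml.
apply: eq_bigr => A AS; have kA := notin_subset kS AS.
rewrite weight_setU1_notin // weight_setU1 //.
rewrite quadraticA_plus_inv // quadraticB_plus_inv //.
set P := \prod_(j in S) (cubicD j).[v k].
have -> : \prod_(i in S) (if i \in A then (cubicD i).[v k] else (cubicA i).[v k])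
  = \prod_(j in S) (if j \in A then 1 else rho q t (v k / v j)) * P.
  rewrite -big_split; apply: eq_bigr => i iS /=.
  by case: ifP => _; rewrite ?mul1r // rho_cubicA // (neq_of_notin kS).
have -> : \prod_(i in S) (if i \in A then (cubicB i).[v k] else (cubicD i).[v k])
  = \prod_(i in S) (if i \in A then rho q t (v i / v k) else 1) * P.
  rewrite -big_split; apply: eq_bigr => i iS /=.
  by case: ifP => _; rewrite ?mul1r // rho_cubicB // (neq_of_notin kS).
ring.
Qed.

(* At a root of [cubicD k] only the summands separating the new variable
   from [k] survive. *)
Lemma horner_numer_cubicD0 S x y k z : k \notin S -> (cubicD k).[z] = 0 ->
  (numer (k |: S) x y).[z] =
  \sum_(A : {set I} | A \subset S) weight S A x y *
    ((y + plus_inv (v k / t)) * (quadratic 1 x 1).[z] * (cubicA k).[z] *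
       \prod_(i in S) (if i \in A then rho q t (v i / v k) * (cubicD i).[z]
                       else (cubicA i).[z]) +
     (x + plus_inv (v k)) * (quadratic t y t^-1).[z] * (cubicB k).[z] *
       \prod_(j in S) (if j \in A then (cubicB j).[z]
                       else rho q t (v k / v j) * (cubicD j).[z])).
Proof.
move=> kS D0; rewrite horner_numer big_subset_setU1 //.
apply: eq_bigr => A AS; have kA := notin_subset kS AS.
rewrite weight_setU1_notin // weight_setU1 // !big_setU1 //= (negbTE kA) setU11.
rewrite D0 !(mul0r, mulr0, addr0, add0r).
have inU i : i \in S -> (i \in k |: A) = (i \in A).
  by move=> iS; rewrite in_setU1 (negbTE (neq_of_notin kS iS)).
under [X in _ + _ * (_ * (_ * X)) = _]eq_bigr => i iS do rewrite inU //.
have -> : \prod_(i in S) (if i \in A then rho q t (v i / v k) * (cubicD i).[z]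
     else (cubicA i).[z]) =
  \prod_(i in S) (if i \in A then rho q t (v i / v k) else 1) *
  \prod_(i in S) (if i \in A then (cubicD i).[z] else (cubicA i).[z]).
  by rewrite -big_split; apply: eq_bigr => i _ /=; case: ifP; rewrite ?mul1r.
have -> : \prod_(i in S) (if i \in A then (cubicB i).[z]
     else rho q t (v k / v i) * (cubicD i).[z]) =
  \prod_(i in S) (if i \in A then 1 else rho q t (v k / v i)) *
  \prod_(i in S) (if i \in A then (cubicB i).[z] else (cubicD i).[z]).
  by rewrite -big_split; apply: eq_bigr => i _ /=; case: ifP; rewrite ?mul1r.
ring.
Qed.

(** When z = v_k, exchanging the roles of the new index and [k] matches the two surviving summands
    up to sign, because [cubicA k] and [cubicB k] take opposite values there. *)
Lemma horner_numer_root S x y k : k \notin S -> (numer (k |: S) x y).[v k] = 0.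
Proof.
move=> kS; rewrite horner_numer_cubicD0 //; last first.
  by rewrite horner_cubic; field; rewrite t0 v0.
apply: big1 => A AS; rewrite quadraticA_plus_inv // quadraticB_plus_inv //.
have -> : (cubicA k).[v k] = - (cubicB k).[v k].
  by rewrite !horner_cubic; field; rewrite q0 t0 v0.
rewrite [X in _ + _ * X](_ : _ =
  \prod_(i in S) (if i \in A then rho q t (v i / v k) * (cubicD i).[v k]
                  else (cubicA i).[v k])); first by ring.
apply: eq_bigr => i iS; have ik := neq_of_notin kS iS.
by rewrite rho_cubicA ?rho_cubicB.
Qed.

(** [cubicB k] also vanishes here, so only the summand with the new index inside [A] remains;
    [rho_cubicA_div] then makes its product independent of [A]. *)
Lemma horner_numer_div S x y k : k \notin S ->
  let z := v k / t in
  (numer (k |: S) x y).[z] = subset_sum S x y *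
    (z * (x + plus_inv z) * (y + plus_inv z) *
     \prod_(i in k |: S) (cubicA i).[z]).
Proof.
move=> kS z; rewrite horner_numer_cubicD0 //; last first.
  by rewrite horner_cubic /z; field; rewrite t0 v0.
rewrite /subset_sum mulr_suml; apply: eq_bigr => A AS.
have -> : (cubicB k).[z] = 0 by rewrite horner_cubic /z; field; rewrite q0 t0 v0.
have z0 : z != 0 by rewrite mulf_neq0 ?invr_eq0.
rewrite quadraticA_plus_inv // big_setU1 //= -/z.
under eq_bigr => i iS do rewrite rho_cubicA_div ?(neq_of_notin kS iS) // if_same.
ring.
Qed.

(** Mirror case: [cubicA k] vanishes, and the new index lies outside [A]. *)
Lemma horner_numer_mul S x y k : k \notin S ->
  let z := t * v k in
  (numer (k |: S) x y).[z] = subset_sum S x y *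
    (z * (x + plus_inv (v k)) * (y + plus_inv (v k)) *
     \prod_(i in k |: S) (cubicB i).[z]).
Proof.
move=> kS z; rewrite horner_numer_cubicD0 //; last first.
  by rewrite horner_cubic /z; field; rewrite t0 v0.
rewrite /subset_sum mulr_suml; apply: eq_bigr => A AS.
have -> : (cubicA k).[z] = 0 by rewrite horner_cubic /z; field; rewrite q0 t0 v0.
have z0 : z != 0 by rewrite mulf_neq0.
have ztE : z / t = v k by rewrite /z mulrC mulKf.
rewrite quadraticB_plus_inv // big_setU1 //= ztE.
under [X in _ * (_ + _ * X) = _]eq_bigr => i iS
  do rewrite rho_cubicB_mul ?(neq_of_notin kS iS) // if_same.
ring.
Qed.

(** * Extreme coefficients of the numerator *)

Let cDA A k := if k \in A then (1 / (t * v k), 1 / v k, t / v k)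
  else (q / v k, t / (q * v k), 1 / (t * v k)).
Let cBD A k := if k \in A then (q / (t * v k), 1 / (q * v k), t / v k)
  else (1 / (t * v k), 1 / v k, t / v k).

Lemma numer_termE S A x y : numer_term S A x y =
  quadratic 1 x 1 *
    (\prod_(k in S) cubic (cDA A k).1.1 (cDA A k).1.2 (cDA A k).2)
  + quadratic t y t^-1 *
    \prod_(k in S) cubic (cBD A k).1.1 (cBD A k).1.2 (cBD A k).2.
Proof.
rewrite /numer_term /cDA /cBD.
by congr (_ * _ + _ * _); apply: eq_bigr => k _; case: ifP.
Qed.

Lemma numer_term_coef0 S A x y : (numer_term S A x y)`_0 = 1 + t.
Proof. by rewrite numer_termE coefD !quadratic_prod_cubic_coef0. Qed.

(** Once the second product is weighted by its constant term [t], an index [k] contributes the same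
    six terms whether or not it lies in [A]. *)
Lemma numer_term_coef1 S A x y : (numer_term S A x y)`_1 =
  x + y - \sum_(k in S) (q + t / q + t^-1 + 1 + t + t ^+ 2) / v k.
Proof.
rewrite numer_termE coefD !quadratic_prod_cubic_coef1 mul1r addrACA.
rewrite -opprD mulr_sumr -big_split; congr (_ - _); apply: eq_bigr => k _ /=.
by rewrite /cDA /cBD; case: ifP => _ /=; field; rewrite q0 t0 v0.
Qed.

(** The parameters of each of [cubicA k], [cubicB k] and [cubicD k] have product v_k^(-3), so
    membership in [A] does not matter. *)
Lemma numer_term_top S A x y :
  (size (numer_term S A x y) <= (2 + 3 * #|S|).+1)%N /\
  (numer_term S A x y)`_(2 + 3 * #|S|) =
    (1 + t^-1) * \prod_(k in S) - (v k ^- 3).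
Proof.
rewrite numer_termE coefD.
have [sA ->] := quadratic_prod_cubic_top S (fun k => (cDA A k).1.1)
  (fun k => (cDA A k).1.2) (fun k => (cDA A k).2) 1 x 1.
have [sB ->] := quadratic_prod_cubic_top S (fun k => (cBD A k).1.1)
  (fun k => (cBD A k).1.2) (fun k => (cBD A k).2) t y t^-1.
split; first by rewrite (leq_trans (size_polyD _ _)) // geq_max sA.
rewrite mulrDl; congr (_ * _ + _ * _); apply: eq_bigr => k _;
  by rewrite /cDA /cBD; case: ifP => _ /=; field; rewrite ?q0 ?t0 v0.
Qed.

Lemma coef_numer S x y m c :
  (forall A, (numer_term S A x y)`_m = c) ->
  (numer S x y)`_m = subset_sum S x y * c.
Proof.
move=> cE; rewrite coef_sum mulr_suml; apply: eq_bigr => A _.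
by rewrite coefZ cE.
Qed.

Lemma generic_points_uniq S :
  uniq (0 :: [seq t ^+ e / t * v k | e <- iota 0 3, k <- enum S]).
Proof.
rewrite cons_uniq; apply/andP; split.
  apply/negP=> /allpairsP[[e k] /= [_ _ /esym/eqP]].
  by rewrite !mulf_eq0 invr_eq0 expf_eq0 (negbTE t0) (negbTE (v0 k)) andbF.
apply: allpairs_uniq; rewrite ?iota_uniq ?enum_uniq //.
move=> p1 p2.
(* Genericity speaks of nonnegative powers of [t] only, hence the ordering of the exponents. *)
have inj e1 e2 k1 k2 : (e2 <= 2)%N -> (e1 <= e2)%N ->
    t ^+ e1 / t * v k1 = t ^+ e2 / t * v k2 -> (e1, k1) = (e2, k2).
  move=> e22 e12 e; have vE : v k1 = t ^+ (e2 - e1) * v k2.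
    have te0 : t ^+ e1 / t != 0 by rewrite mulf_neq0 ?invr_eq0 ?expf_neq0.
    apply: (mulfI te0); rewrite e mulrA; congr (_ * _).
    by rewrite mulrAC -exprD subnKC.
  apply/eqP; rewrite xpair_eqE; apply/negPn/negP => ne.
  rewrite negb_and orbC in ne.
  have := @v_generic k1 k2 (e2 - e1) (leq_trans (leq_subr _ _) e22).
  by rewrite -vE eqxx subn_gt0 ltn_neqAle e12 andbT => /(_ ne).
case/allpairsP=> -[e1 k1] [i1 _ ->] /allpairsP[[e2 k2] [i2 _ ->]].
move: i1 i2; rewrite !mem_iota /= => i1 i2 e.
by case/orP: (leq_total e1 e2) => le; [|symmetry]; apply: inj.
Qed.

(** Symmetry on [S] kills coefficients 0, 1 and the top one of the difference; symmetry on each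
    [S :\ k] makes v_k/t and t v_k roots, while v_k is always one. These 3#|S| roots exhaust the
    degree. *)
Lemma numer_sym S : (forall x y, subset_sum S x y = subset_sum S y x) ->
  (forall k x y, k \in S -> subset_sum (S :\ k) x y = subset_sum (S :\ k) y x) ->
  forall x y, numer S x y = numer S y x.
Proof.
move=> symS symS1 x y; apply/eqP; rewrite -subr_eq0; apply/eqP.
have top z w A := proj2 (numer_term_top S A z w).
have sN z w : (size (numer S z w) <= (2 + 3 * #|S|).+1)%N.
  apply: (leq_trans (size_sum _ _ _)); apply/bigmax_leqP => A _.
  by apply: (leq_trans (size_scale_leq _ _)); case: (numer_term_top S A z w).
apply: (double_root0_poly_eq0 (m := 3 * #|S|) _ _ _ _ (generic_points_uniq S)).
- by rewrite (leq_trans (size_polyD _ _)) // size_polyN geq_max !sN.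
- rewrite coefB !(coef_numer (fun A => numer_term_coef0 S A _ _)).
  by rewrite symS subrr.
- rewrite coefB !(coef_numer (fun A => numer_term_coef1 S A _ _)).
  by rewrite symS [y + x]addrC subrr.
- by rewrite coefB !(coef_numer (top _ _)) symS subrr.
- by rewrite size_allpairs size_iota -cardE.
apply/allP=> _ /allpairsP[[e k] [ei kS ->]].
move: ei; rewrite mem_iota mem_enum /= in kS * => ei.
rewrite rootE hornerD hornerN subr_eq0; apply/eqP.
have kS' : k \notin S :\ k by rewrite setD11.
rewrite -(setD1K kS); case: e ei => [|[|[|//]]] _.
- rewrite expr0 div1r mulrC !horner_numer_div // symS1 //; ring.
- by rewrite expr1 divff // mul1r !horner_numer_root.
- by rewrite expr2 mulfK // !horner_numer_mul // symS1 //; ring.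
Qed.

Lemma subset_sum_sym S x y : subset_sum S x y = subset_sum S y x.
Proof.
have [m] := ubnP #|S|; elim: m => // m IH in S x y *.
have [->|[k kS]] := set_0Vmem S.
  by move=> _; apply: eq_bigr => A _; rewrite /weight !big_set0.
rewrite (cardsD1 k) kS ltnS => ltS.
have kS' : k \notin S :\ k by rewrite setD11.
(* The cleared denominator is nonzero at v_k, so symmetry of the numerator over [S :\ k] gives
   symmetry over [S]. *)
have D0 : v k * \prod_(j in S :\ k) (cubicD j).[v k] != 0.
  rewrite mulf_neq0 //; apply/prodf_neq0 => j jS.
  have jk := neq_of_notin kS' jS.
  have h0 := @sub_generic 0 k j isT; have h1 := @sub_generic 1 j k isT.
  have h2 := @sub_generic 1 k j isT.
  rewrite jk eq_sym jk !expr1 expr0 mul1r in h0 h1 h2.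
  rewrite horner_cubic.
  have -> : (1 - 1 / (t * v j) * v k) * (1 - 1 / v j * v k) *
    (1 - t / v j * v k) = (t * v j - v k) * (v j - v k) * (v j - t * v k)
      / (t * v j ^+ 3) by field; rewrite t0 v0.
  rewrite !mulf_neq0 ?invr_eq0 ?mulf_neq0 ?expf_neq0 ?h1 //;
    by rewrite -oppr_eq0 opprB ?h0 ?h2.
apply: (mulIf D0); rewrite -(setD1K kS) setU1K //.
rewrite -!horner_numer_setU1 //; congr (_.[_]).
apply: numer_sym => [z w|j z w jS]; apply: IH => //.
by apply: leq_trans ltS; rewrite ltnS subset_leq_card // subD1set.
Qed.

End TwoVariables.

(** * Reduction to adjacent transpositions *)

Lemma symmetric_adjacent (R : nzRingType) n (p : {mpoly R[n]}) :
  (forall a b : 'I_n, b = a.+1 :> nat -> msym (tperm a b) p = p) ->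
  p \is symmetric.
Proof.
move=> adj; apply/issymP => s.
have lt_fix m (a b : 'I_n) : b = (a + m).+1 :> nat -> msym (tperm a b) p = p.
  elim: m => [|m IH] in b *; first by rewrite addn0; apply: adj.
  rewrite addnS => eb; have ltc : ((a + m).+1 < n)%N.
    by rewrite -eb ltnW // ltn_ord.
  pose c := Ordinal ltc.
  have cb : msym (tperm c b) p = p by apply: adj.
  have ac : a != c by rewrite -val_eqE /= neq_ltn ltnS leq_addr.
  have ab : a != b by rewrite -val_eqE /= eb neq_ltn !ltnS leqW ?leq_addr.
  (* With [c] just before [b], conjugation shortens the distance by one. *)
  have -> : tperm a b = ((tperm a c) ^ (tperm c b))%g.
    by rewrite tpermJ tpermL tpermD // eq_sym.
  by rewrite conjgE tpermV mulgA !msymMm cb IH // cb.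
have tperm_fix (a b : 'I_n) : msym (tperm a b) p = p.
  have [ab|ba|/val_inj->] := ltngtP a b; last by rewrite tperm1 msym1m.
    by apply: (lt_fix (b - a.+1)%N); rewrite -addSn subnKC.
  by rewrite tpermC; apply: (lt_fix (a - b.+1)%N); rewrite -addSn subnKC.
have [ts -> _] := prod_tpermP s.
elim: ts => [|[a b] ts IH]; first by rewrite big_nil msym1m.
by rewrite big_cons msymMm tperm_fix.
Qed.

(** * Grouping functions by merging two values *)

Section SplitValue.
Variables (I T : finType) (a b : T).

Definition split_value (h : {ffun I -> T}) (A : {set I}) : {ffun I -> T} :=
  [ffun i => if h i == a then (if i \in A then a else b) else h i].

(** A function is determined by its merge, which replaces [b] by [a], together with the set where it
    equals [a]. *)
Lemma big_split_value (V : nmodType) (F : {ffun I -> T} -> V) : a != b ->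
  \sum_f F f = \sum_(h : {ffun I -> T} | [forall i, h i != b])
    \sum_(A : {set I} | A \subset [set i | h i == a]) F (split_value h A).
Proof.
move=> ab.
pose merge (f : {ffun I -> T}) : {ffun I -> T} :=
  [ffun i => if f i == b then a else f i].
rewrite (partition_big merge (fun h => [forall i, h i != b])) /=; last first.
  by move=> f _; apply/forallP => i; rewrite ffunE; case: ifP => // ->.
apply: eq_bigr => h /forallP hb.
rewrite (reindex_onto (split_value h) (fun f => [set i | f i == a])).
  apply: eq_bigl => A; apply/andP/idP => [[_ /eqP eA]|AS].
    apply/subsetP=> i; rewrite -eA !inE ffunE.
    by case: (eqVneq (h i) a) => // /negbTE->.
  split; apply/eqP.
    apply/ffunP=> i; rewrite !ffunE; have [->|_] := eqVneq (h i) a.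
      by case: (i \in A); rewrite ?eqxx ?(negbTE ab).
    by rewrite (negbTE (hb i)).
  apply/setP=> i; rewrite !inE ffunE; have [hi|hi] := eqVneq (h i) a.
    by case: (i \in A); rewrite ?eqxx // eq_sym (negbTE ab).
  rewrite (negbTE hi); apply/esym/negbTE; apply: contra hi => iA.
  by have := subsetP AS i iA; rewrite inE.
move=> f /eqP <-; apply/ffunP=> i; rewrite !ffunE inE.
have [->|fb] := eqVneq (f i) b; first by rewrite eqxx eq_sym (negbTE ab).
by case: eqP => [->|].
Qed.

End SplitValue.

Definition generic_params (K : fieldType) d (q t : K) (u : 'I_d -> K) : Prop :=
  [/\ q != 0, t != 0, forall i, u i != 0 &
      forall i j e, (e <= 2)%N -> (i != j) || (0 < e)%N ->
        u i != t ^+ e * u j].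

Lemma msym_mpolyXU (R : nzRingType) n (s : 'S_n) i :
  msym s ('X_i : {mpoly R[n]}) = 'X_(s i).
Proof.
rewrite msymX; congr 'X_[_]; apply/mnmP=> j; rewrite mnmE !mnm1E.
by rewrite -(inj_eq (@perm_inj _ s)) permKV.
Qed.

Lemma msym_mpolyC (R : nzRingType) n (s : 'S_n) (k : R) :
  msym s k%:MP_[n] = k%:MP.
Proof. by rewrite -[k%:MP]mulr1 mul_mpolyC msymZ msym1. Qed.

(** * Exchange of two adjacent variables *)

Section Adjacent.
Variables (K L : fieldType) (n d : nat).
Variables (inj : {rmorphism {mpoly K[n]} -> L}) (c : {rmorphism K -> L}).
Hypothesis injC : forall k, inj k%:MP = c k.
Variables (q t : K) (u : 'I_d -> K).
Hypothesis params : generic_params q t u.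
Variables (a b : 'I_n).
Hypothesis ba : b = a.+1 :> nat.

(** This rescaling turns the constants at the values [a] and [b] into [plus_inv (v i)] and
    [plus_inv (v i / c t)], and preserves the ratios on which [rho] depends. *)
Let v (i : 'I_d) : L := c (u i / t ^+ a.+1).

Let term (f : {ffun 'I_d -> 'I_n}) : {mpoly K[n]} :=
  (\prod_(p : 'I_d * 'I_d | (f p.1 < f p.2)%N) rho q t (u p.1 / u p.2))
     *: \prod_(i < d)
          ('X_(f i) + (u i / t ^+ (f i).+1 + t ^+ (f i).+1 / u i)%:MP).

(* The part of the image of [term (split_value a b h A)] that depends neither
   on [A] nor on the exchange of the variables [a] and [b]. *)
Let outer (h : {ffun 'I_d -> 'I_n}) : L :=
  (\prod_(p : 'I_d * 'I_d)
     (if (h p.1 == a) && (h p.2 == a) then 1 else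
      if (h p.1 < h p.2)%N then c (rho q t (u p.1 / u p.2)) else 1))
  * \prod_(i < d | h i != a)
      inj ('X_(h i) + (u i / t ^+ (h i).+1 + t ^+ (h i).+1 / u i)%:MP).

Lemma c_rho i j : c (rho q t (u i / u j)) = rho (c q) (c t) (v i / v j).
Proof.
have [_ t0 u0 _] := params.
have -> : v i / v j = c (u i / u j).
  rewrite /v -fmorph_div; congr (c _); field.
  by rewrite u0 expf_neq0.
by rewrite /rho !(rmorphM, fmorphV, rmorphB, rmorph1).
Qed.

Lemma msym_term (s : 'S_n) (h : {ffun 'I_d -> 'I_n}) (A : {set 'I_d}) :
  (forall i, i != a -> i != b -> s i = i) ->
  [forall i, h i != b] -> A \subset [set i | h i == a] ->
  inj (msym s (term (split_value a b h A))) =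
  outer h * weight (c q) (c t) v [set i | h i == a] A
    (inj 'X_(s a)) (inj 'X_(s b)).
Proof.
move=> sE /forallP hb AS; have [q0 t0 u0 _] := params.
have ab : a != b by rewrite -val_eqE /= ba neq_ltn ltnSn.
rewrite /term msymZ -mul_mpolyC rmorphM /= injC.
rewrite !rmorph_prod /outer /weight mulrACA; congr (_ * _).
  rewrite big_mkcond pair_big /=; under [X in _ * X]eq_bigl do rewrite !inE.
  rewrite [X in _ * X]big_mkcond -big_split; apply: eq_bigr => -[i j] _ /=.
  (* No value lies strictly between [a] and [b], and [h] avoids [b]: an index outside the fibre of
     [a] compares alike with both. *)
  have hltb k : (h k < b)%N = (h k <= a)%N by rewrite ba ltnS.
  have bltk k : (b < h k)%N = (a < h k)%N.
    by rewrite ba ltn_neqAle eq_sym -ba val_eqE hb.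
  rewrite !ffunE; have [hi|hi] := eqVneq (h i) a;
    have [hj|hj] := eqVneq (h j) a; rewrite /= ?mulr1 ?mul1r ?c_rho //.
  - case: (i \in A); case: (j \in A);
      by rewrite /= ?ltnn ?ba ?ltnSn ?[(a.+1 < a)%N]ltnNge ?leqnSn.
  - by rewrite hi; case: (i \in A); rewrite ?bltk.
  - rewrite hj; case: (j \in A) => //; rewrite hltb leq_eqVlt.
    by rewrite val_eqE (negbTE hi).
rewrite (bigID (fun i => h i == a)) /= mulrC; congr (_ * _).
  apply: eq_bigr => i hi; rewrite ffunE (negbTE hi).
  by rewrite msymD msym_mpolyXU sE // msym_mpolyC.
apply: eq_big => [i|i /eqP hi]; first by rewrite inE.
rewrite !ffunE hi eqxx msymD msym_mpolyXU msym_mpolyC rmorphD /= injC.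
have vE : plus_inv (v i) = c (u i / t ^+ a.+1 + t ^+ a.+1 / u i).
  by rewrite /plus_inv /v -fmorphV -rmorphD; congr (c _); rewrite invf_div.
have vtE : plus_inv (v i / c t) = c (u i / t ^+ b.+1 + t ^+ b.+1 / u i).
  rewrite /plus_inv /v -fmorph_div -fmorphV -rmorphD; congr (c _).
  by rewrite -mulrA -invfM -exprSr -ba invf_div.
by case: (i \in A); rewrite ?vE ?vtE.
Qed.

Lemma msym_adjacent : injective inj ->
  msym (tperm a b) (generic_macdonald n q t u) = generic_macdonald n q t u.
Proof.
move=> inj_inj; have [q0 t0 u0 gen] := params.
have ab : a != b by rewrite -val_eqE /= ba neq_ltn ltnSn.
(* Used for the identity and for [tperm a b]: the two images differ only by the order of the last
   two arguments of [subset_sum]. *)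
have E (s : 'S_n) : (forall i, i != a -> i != b -> s i = i) ->
  inj (msym s (generic_macdonald n q t u)) =
  \sum_(h : {ffun 'I_d -> 'I_n} | [forall i, h i != b])
    outer h * subset_sum (c q) (c t) v [set i | h i == a]
      (inj 'X_(s a)) (inj 'X_(s b)).
  move=> sE; rewrite /generic_macdonald (big_split_value _ ab).
  rewrite [msym s _]raddf_sum raddf_sum.
  apply: eq_bigr => h hb; rewrite mulr_sumr /= [msym s _]raddf_sum raddf_sum.
  apply: eq_bigr => A AS.
  exact: msym_term.
apply: inj_inj; rewrite -[in RHS](msym1m (generic_macdonald _ _ _ _)).
rewrite !E => [|i _ _|i ia ib]; [|by rewrite perm1|by rewrite tpermD // eq_sym].
apply: eq_bigr => h _; rewrite tpermL tpermR !perm1; congr (_ * _).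
apply: subset_sum_sym; rewrite ?fmorph_eq0 //.
  by move=> i; rewrite fmorph_eq0 mulf_neq0 ?invr_eq0 ?expf_neq0.
move=> i j e e2 ije; rewrite /v -rmorphXn -rmorphM.
rewrite (inj_eq (fmorph_inj _)) mulrA.
by rewrite (inj_eq (mulIf _)) ?gen // invr_eq0 expf_neq0.
Qed.

End Adjacent.

Lemma generic_macdonald_symmetric (K : fieldType) n d (q t : K) (u : 'I_d -> K) :
  generic_params q t u -> generic_macdonald n q t u \is symmetric.
Proof.
move=> params; apply: symmetric_adjacent => a b ba.
(* In the fraction field of the polynomial ring the variables become scalars, as the two-variable
   identity requires. *)
apply: (msym_adjacent (inj := @tofrac {mpoly K[n]})
  (c := @tofrac {mpoly K[n]} \o @mpolyC n K) (fun=> erefl) params ba).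
by move=> p1 p2 /eqP; rewrite tofrac_eq => /eqP.
Qed.

(** * Genericity of the indeterminates *)

Lemma generic_params_indet d :
  generic_params (q_indet d) (t_indet d) (@u_indet d).
Proof.
have indet0 k : indet (d := d) k != 0.
  rewrite tofrac_eq0; apply/eqP => /(congr1 (meval (fun=> 1))).
  by rewrite mevalXU meval0.
split; [exact: indet0|exact: indet0|move=> i; exact: indet0|].
move=> i j e e2 ije.
rewrite /u_indet /t_indet /indet -rmorphXn -rmorphM tofrac_eq.
pose w (k : 'I_(2 + d)) : rat :=
  (* Specializing u_i to 5, [t] to 2 and the rest to 1 separates the two sides: 5 is none of 1, 2, 4
     when i and j differ, and neither 10 nor 20 when they agree. *)
  if k == rshift 2 i then 5 else if k == lshift d ord_max then 2 else 1.
apply/eqP => /(congr1 (meval w)); rewrite mevalM rmorphXn /= !mevalXU /w.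
rewrite eqxx eq_lrshift eqxx eq_rshift [j == i]eq_sym.
by case: (i == j) ije => /=; case: e e2 => [|[|[|]]].
Qed.

Theorem theorem1 (n d : nat) (hn : (1 <= n)%N) :
  generic_macdonald n (q_indet d) (t_indet d) (@u_indet d) \is symmetric.
Proof. exact: generic_macdonald_symmetric (generic_params_indet d). Qed.
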